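(* Let $X\in\mathcal{X}\subseteq\mathbb{R}$ and $Y\in\mathcal{Y}\subseteq\mathbb{R}$ be random variables such that the conditional pdf of $Y$ given $X$ has the univariate exponential family form $$f_{Y|X}(y|x) = h(y)\, e^{x T(y) - \phi(x)}, \qquad y\in\mathcal{Y},\ x\in\mathcal{X},$$ with marginal pdf $f_Y$ of $Y$, and assume the regularity conditions (R) listed in the context. For integers $\ell\ge1$ let $$\kappa_{X|Y=y}(\ell) = \frac{\mathrm{d}^\ell}{\mathrm{d}t^\ell} \log \mathbb{E}[e^{tX}|Y=y] \Big|_{t=0}$$ be the $\ell$-th conditional cumulant, and let $D_y^{(\ell)}$ be the $\ell$-fold composition of the operator $\frac{1}{T'(y)}\frac{\mathrm{d}}{\mathrm{d}y}$. Then, for every integer $\ell\ge1$ and every $y\in\mathcal{Y}$ with $T'(y)\neq0$, $$\kappa_{X|Y=y}(\ell+1) = \frac{1}{T'(y)}\frac{\mathrm{d}}{\mathrm{d}y}\,\kappa_{X|Y=y}(\ell)$$ and $$\kappa_{X|Y=y}(\ell) = D_y^{(\ell)} \log\left(\frac{f_Y(y)}{h(y)}\right).$$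
   Context: Exponential family: $T:\mathcal{Y}\to\mathbb{R}$ is the sufficient statistic, $\phi:\mathcal{X}\to\mathbb{R}$ the log-partition function, $h:\mathcal{Y}\to[0,\infty)$ the base measure. Standing assumptions: $\mathcal{Y}$ is open, $h$ is absolutely continuous with respect to Lebesgue measure, and $T$ is analytic, with $T'$ having only isolated zeros (the operator $D_y^{(\ell)}$ is not defined at those zeros). It is implicit that $h$ and $f_Y$ are positive on $\mathcal{Y}$, so that $\log(f_Y/h)$ is defined. Regularity conditions (R): for every $t\in\mathbb{R}$: $\mathbb{E}[e^{tX} \mid Y=y]<\infty$, $\mathbb{E}[e^{tX}|X| \mid Y=y]<\infty$ and $\mathbb{E}[|X| \mid Y=y]<\infty$ for all $y\in\mathcal{Y}$; and $y\mapsto e^{tx}\,\iota_{P_{X,Y}}(x;y)$ and $y\mapsto f_{Y|X}(y|x)$ are absolutely continuous for every $x$. Here $\iota_{P_{X,Y}}(x;y) = \log\frac{f_{Y|X}(y|x)}{f_Y(y)}$ is the information density. *)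

(* Defs.v *)
From HB Require Import structures.
From mathcomp Require Import all_boot all_order all_algebra.
From mathcomp Require Import all_classical all_reals all_analysis.

Set Implicit Arguments.
Unset Strict Implicit.
Unset Printing Implicit Defensive.

Import Order.TTheory GRing.Theory Num.Theory.
Import numFieldNormedType.Exports.

Local Open Scope classical_set_scope.
Local Open Scope ring_scope.

(* Functions attached to a subset of the line (h, T and the pdf of Y on the set
   U of values of Y, phi on the set of values of X) are total functions on R
   whose values outside that subset are never used. *)

Section Regularity.
Context {R : realType}.

Definition analytic_on (U : set R) (f : R -> R) : Prop :=
  forall x, U x -> exists a : nat -> R,
    \forall y \near x, pseries a (y - x) @ \oo --> f y.

Definition abs_continuous_itv (f : R -> R) (a b : R) : Prop :=
  forall e : R, 0 < e -> exists2 d : R, 0 < d &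
    forall (n : nat) (u v : 'I_n -> R),
      (forall i, a <= u i /\ u i < v i /\ v i <= b) ->
      trivIset setT (fun i => [set` `]u i, v i[]) ->
      \sum_(i < n) (v i - u i) < d ->
      \sum_(i < n) `|f (v i) - f (u i)| < e.

(* On an open set, absolute continuity is understood on compact subintervals:
   log-densities such as those of the Gaussian family are not even uniformly
   continuous on the whole line. *)
Definition abs_continuous_on (U : set R) (f : R -> R) : Prop :=
  forall a b, a < b -> [set` `[a, b]] `<=` U -> abs_continuous_itv f a b.

End Regularity.

Section ExponentialFamily.
Context {R : realType}.
Local Notation mu := (@lebesgue_measure R).

(* h(y)dy is the base measure, carried by U. *)
Definition base_density (U : set R) (h : R -> R) : Prop :=
  [/\ forall y, U y -> 0 <= h y,
      measurable_fun U h
    & exists2 nu : {measure set R -> \bar R}, nu `<< mu &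
        forall B, measurable B -> nu B = (\int[mu]_(y in B `&` U) (h y)%:E)%E].

(* lne is the extended logarithm, so the integral is positive and finite. *)
Definition log_partition (V U : set R) (h T phi : R -> R) : Prop :=
  forall x, V x ->
    (phi x)%:E = lne (\int[mu]_(y in U) (h y * expR (x * T y))%:E)%E.

End ExponentialFamily.

Section Conditioning.
Context {R : realType} {d : measure_display} {Omega : measurableType d}.
Context (P : probability Omega R) (X Y : {RV P >-> R}).
Local Notation mu := (@lebesgue_measure R).

(* f y x stands for f_{Y|X}(y|x). *)
Definition is_conditional_pdf (V U : set R) (f : R -> R -> R) : Prop :=
  [/\ forall x y, V x -> U y -> 0 <= f y x,
      forall x, V x -> (\int[mu]_(y in U) (f y x)%:E = 1)%E
    & forall A B : set R, measurable A -> measurable B ->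
        P (X @^-1` A `&` Y @^-1` B) =
        (\int[P]_(w in X @^-1` A) \int[mu]_(y in B `&` U) (f y (X w))%:E)%E].

(* A density is only unique almost everywhere; the last clause selects the
   version f_Y(y) = E[f_{Y|X}(y|X)], which is finite at every point of U. *)
Definition is_marginal_pdf (U : set R) (f : R -> R -> R) (fY : R -> R) : Prop :=
  [/\ forall y, U y -> 0 <= fY y,
      forall B : set R, measurable B ->
        P (Y @^-1` B) = (\int[mu]_(y in B `&` U) (fY y)%:E)%E
    & forall y, U y -> (fY y)%:E = ('E_P[fun w => f y (X w)])%E].

(* E[g(X) | Y = y], for the conditional law of X given Y = y provided by
   Bayes' formula: dP_{X|Y=y}/dP_X (x) = f_{Y|X}(y|x) / f_Y(y). *)
Definition cond_expectation (f : R -> R -> R) (fY : R -> R)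
    (g : R -> R) (y : R) : \bar R :=
  ('E_P[fun w => (g (X w) * (f y (X w) / fY y))%R])%E.

Definition information_density (f : R -> R -> R) (fY : R -> R) (x y : R) : R :=
  ln (f y x / fY y).

Definition cond_cgf (f : R -> R -> R) (fY : R -> R) (y t : R) : R :=
  ln (fine (cond_expectation f fY (fun x => expR (t * x)) y)).

Definition cond_cumulant (f : R -> R -> R) (fY : R -> R) (l : nat) (y : R) : R :=
  derive1n l (cond_cgf f fY y) 0.

Definition regularity_conditions (V U : set R) (f : R -> R -> R)
    (fY : R -> R) : Prop :=
  forall t : R,
  [/\ forall y, U y ->
        (cond_expectation f fY (fun x => expR (t * x))%R y < +oo)%E,
      forall y, U y ->
        (cond_expectation f fY (fun x => expR (t * x) * `|x|)%R y < +oo)%E,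
      forall y, U y -> (cond_expectation f fY (fun x => `|x|)%R y < +oo)%E,
      forall x, V x -> abs_continuous_on U
        (fun y => expR (t * x) * information_density f fY x y)
    & forall x, V x -> abs_continuous_on U (fun y => f y x)].

End Conditioning.

Definition diff_op {R : realType} (T : R -> R) (l : nat) (g : R -> R) : R -> R :=
  iter l (fun u y => (derive1 T y)^-1 * derive1 u y) g.

(* Main.v *)
Require Import Defs.
From HB Require Import structures.
From mathcomp Require Import all_boot all_order all_algebra.
From mathcomp Require Import all_classical all_reals all_analysis.
From mathcomp Require Import measurable_realfun ring lra.

Set Implicit Arguments.
Unset Strict Implicit.
Unset Printing Implicit Defensive.

Import Order.TTheory GRing.Theory Num.Theory.
Import numFieldNormedType.Exports.

Local Open Scope classical_set_scope.
Local Open Scope ring_scope.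

(** Let [M(s) = E[exp(s X - phi(X))]] and [K = ln M].  Bayes' formula gives
    [f_Y(y) = h(y) M(T(y))] and [E[exp(t X) | Y = y] = M(t + T(y)) / M(T(y))],
    so the conditional cumulant generating function at [y] is
    [t |-> K(t + T(y)) - K(T(y))] and [ln (f_Y / h) = K \o T].  Hence the [l]-th
    cumulant is [K^(l)(T(y))], and both identities are the chain rule.  [M] is
    finite on the whole line by the regularity conditions, hence smooth by
    differentiation under the integral sign. *)

(** * Derivatives of analytic functions *)

Section PowerSeries.
Context {R : realType}.
Implicit Types (a : nat -> R) (x z : R).

Lemma bernoulli_inequality (r : R) n : 0 <= r -> 1 + n%:R * r <= (1 + r) ^+ n.
Proof.
move=> r0; elim: n => [|n IH]; first by rewrite mul0r addr0 expr0.
rewrite exprS (le_trans _ (ler_wpM2l _ IH))// ?addr_ge0// -natr1.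
have : 0 <= n%:R * r * r by rewrite !mulr_ge0.
by lra.
Qed.

Lemma is_cvg_series_natmul_geometric (q : R) : 0 <= q < 1 ->
  cvgn (series (fun n => n.+1%:R * q ^+ n)).
Proof.
move=> /andP[q0 q1].
(* n + 1 is at most a multiple of (2 / (1 + q))^n, and 2 q / (1 + q) < 1 *)
pose r := (1 - q) / (1 + q).
have q1' : 0 < 1 + q by rewrite ltr_pwDl.
have r0 : 0 < r by rewrite divr_gt0// subr_gt0.
have r1 : r <= 1 by rewrite ler_pdivrMr//; lra.
have r2 : 1 + r = 2 / (1 + q) by rewrite /r; field; rewrite gt_eqF.
apply: (@series_le_cvg _ _ (geometric r^-1 (q * (1 + r)))).
- by move=> n; rewrite mulr_ge0// exprn_ge0.
- by move=> n /=; rewrite mulr_ge0 ?invr_ge0 ?(ltW r0)// exprn_ge0// mulr_ge0// r2 divr_ge0// ltW.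
- move=> n /=; rewrite exprMn mulrCA [leLHS]mulrC ler_wpM2l ?exprn_ge0//.
  rewrite mulrC ler_pdivlMr// (le_trans _ (bernoulli_inequality _ (ltW r0)))//.
  by rewrite -natr1 mulrDl mul1r addrC lerD2r.
- apply: is_cvg_geometric_series; rewrite ger0_norm.
    by rewrite r2 mulrA ltr_pdivrMr//; lra.
  by rewrite mulr_ge0// r2 divr_ge0// ltW.
Qed.

(** Convergence at [x] bounds [|a n| * |x|^n], so with [q = |z| / |x| < 1] the differentiated series
    is dominated by a multiple of the series of [(n + 1) q^n]. *)
Lemma is_cvg_pseries_diffs_inside a x z :
  cvgn (pseries a x) -> `|z| < `|x| -> cvgn (pseries (pseries_diffs a) z).
Proof.
move=> Cx zx; have [K [Kreal Kf]] := cvg_series_bounded Cx.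
have x0 : 0 < `|x| by exact: le_lt_trans zx.
have Kf1 n : `|a n| * `|x| ^+ n <= `|K + 1|.
  rewrite -normrX -normrM (Kf _ _ n I)// (lt_le_trans _ (ler_norm _))//.
  by rewrite ltrDl.
pose q := `|z| / `|x|.
have q01 : 0 <= q < 1 by rewrite divr_ge0//= ltr_pdivrMr// mul1r.
apply: normed_cvg.
pose C := `|K + 1| / `|x|.
apply: (@series_le_cvg _ _ (C \*: (fun n => n.+1%:R * q ^+ n))).
- by move=> n; exact: normr_ge0.
- move=> n /=; rewrite /C mulr_ge0 ?mulr_ge0 ?invr_ge0// exprn_ge0//.
  by case/andP: q01.
- move=> n; rewrite /pseries_diffs /= !normrM normr_nat normrX.
  rewrite /GRing.scale_fun /= [leRHS]mulrCA -mulrA ler_wpM2l//.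
  rewrite /C /q exprMn exprVn.
  rewrite -[leRHS]mulrA [X in _ <= _ * X]mulrCA [leRHS]mulrCA.
  rewrite [leLHS]mulrC ler_wpM2l ?exprn_ge0//.
  by rewrite -invfM -exprS ler_pdivlMr ?exprn_gt0//.
- by apply: is_cvg_seriesZ; exact: is_cvg_series_natmul_geometric.
Qed.

Lemma is_derive_pseries a x z : cvgn (pseries a x) -> `|z| < `|x| ->
  is_derive z 1 (fun u => limn (pseries a u)) (limn (pseries (pseries_diffs a) z)).
Proof.
move=> Cx zx.
(* [w] runs affinely from [|z|] at -1 to [|x|] at 3. Each differentiation costs some radius, and
   [|z| < w (-1/3) < w 0 < |x|] leaves room for the two that are needed. *)
pose w i := (`|z| * (3 - i) + `|x| * (1 + i)) / 4.
have w_pos i : -1 <= i <= 1 -> `|w i| = w i.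
  move=> /andP[i0 i1]; rewrite ger0_norm// divr_ge0// addr_ge0// mulr_ge0//; lra.
have w0 : `|z| < `|w (-1 / 3)|.
  rewrite w_pos ?/w; lra.
apply: (@pseries_snd_diffs _ _ (w (-1 / 3))) => //.
- apply: is_cvg_pseries_inside Cx _; rewrite w_pos ?/w; lra.
- apply: is_cvg_pseries_diffs_inside Cx _; rewrite w_pos ?/w; lra.
- have : cvgn (pseries (pseries_diffs a) (w 0)).
    apply: is_cvg_pseries_diffs_inside Cx _; rewrite w_pos ?/w; lra.
  move/is_cvg_pseries_diffs_inside; apply.
  rewrite !w_pos ?/w; lra.
Qed.

(** The derivative is the differentiated power series centred at [x]. Its continuity at [x] serves
    to keep [T'] away from 0 around a point where it is nonzero. *)
Lemma analytic_is_derive (U : set R) (f : R -> R) x : analytic_on U f -> U x ->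
  exists2 g : R -> R, {for x, continuous g} &
    \forall z \near x, is_derive (z : R) (1 : R) f (g z).
Proof.
move=> fU /fU[a /nbhs_ballP[e /= e0 ae]].
pose g z := limn (pseries (pseries_diffs a) (z - x)).
have Ce : cvgn (pseries a (e / 2)).
  have : ball x e (x + e / 2).
    by rewrite /ball/= opprD addNKr normrN ger0_norm; lra.
  by move/ae; rewrite addrC addKr => /cvgP.
have e2 : e / 4 < `|e / 2| by rewrite ger0_norm; lra.
have Ce4 : cvgn (pseries (pseries_diffs a) (e / 4)).
  apply: is_cvg_pseries_diffs_inside Ce _; rewrite ger0_norm//; lra.
have xd (u : R) : is_derive u (1 : R) (fun z => z - x) 1.
  by rewrite -[X in is_derive _ _ _ X]subr0; apply: is_deriveB.
exists g.
  have gd : is_derive (x - x) 1 (fun u => limn (pseries (pseries_diffs a) u))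
      (limn (pseries (pseries_diffs (pseries_diffs a)) (x - x))).
    apply: is_derive_pseries Ce4 _; rewrite subrr normr0 normr_gt0; lra.
  have [gx _] : is_derive x (1 : R) g _ :=
    @is_derive1_comp _ _ (fun u : R => u - x) _ _ _ gd (xd x).
  exact/differentiable_continuous/derivable1_diffP.
near=> z.
have ze : `|z - x| < e / 4.
  near: z; exists (e / 4) => /=; first lra.
  by move=> z /=; rewrite distrC.
have zd : is_derive (z - x) 1 (fun u => limn (pseries a u)) (g z).
  by apply: is_derive_pseries Ce _; exact: (lt_trans ze).
have : is_derive z 1 (fun u => limn (pseries a (u - x))) (g z).
  rewrite -[g z]mulr1.
  exact: (@is_derive1_comp _ _ (fun u : R => u - x) _ _ _ zd (xd z)).
(* A point [u] within [e / 4] of [z] is within [e / 2] of [x], where the power series still sums to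
   [f]. *)
apply: near_eq_is_derive; near=> u.
apply/cvg_lim => //; apply: ae.
near: u; exists (e / 4) => /=; first lra.
move=> u /=; rewrite distrC => uz; rewrite /ball/= distrC.
rewrite -(subrKA z) (le_lt_trans (ler_normD _ _))//; lra.
Unshelve. all: by end_near. Qed.

End PowerSeries.

(** * Smoothness of the logarithm of a moment generating function *)

Section LogOfSmooth.
Context {R : realType} (M : nat -> R -> R).
Hypothesis M_derive : forall k x, is_derive x (1 : R) (M k) (M k.+1 x).
Hypothesis M0_gt0 : forall x, 0 < M 0%N x.

(* This algebra of functions is stable under differentiation and contains the
   derivative of [ln (M 0)], hence all its higher derivatives. *)
Inductive moment_algebra : (R -> R) -> Prop :=
| MomentCst c : moment_algebra (fun=> c)
| Moment k : moment_algebra (M k)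
| MomentInv : moment_algebra (fun x => (M 0%N x)^-1)
| MomentAdd f g : moment_algebra f -> moment_algebra g ->
    moment_algebra (fun x => f x + g x)
| MomentMul f g : moment_algebra f -> moment_algebra g ->
    moment_algebra (fun x => f x * g x).

Lemma moment_algebra_is_derive f : moment_algebra f ->
  exists2 g, moment_algebra g & forall x, is_derive x (1 : R) f (g x).
Proof.
elim=> [c|k||{}f g _ [f' Af' df] _ [g' Ag' dg]|{}f g Af [f' Af' df] Ag [g' Ag' dg]].
- by exists (fun=> 0); [exact: MomentCst | move=> x; exact: is_derive_cst].
- by exists (M k.+1); [exact: Moment | exact: M_derive].
- exists (fun x => -1 * ((M 0%N x)^-1 * (M 0%N x)^-1) * M 1%N x).
    by do ![apply: MomentMul | exact: MomentCst | exact: MomentInv | exact: Moment].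
  move=> x; apply: is_derive_eq.
    by apply: is_deriveV => //; rewrite gt_eqF.
  by rewrite mulN1r -expr2 exprVn.
- exists (fun x => f' x + g' x); first exact: MomentAdd.
  by move=> x; exact: is_deriveD.
- exists (fun x => f x * g' x + g x * f' x).
    by apply: MomentAdd; apply: MomentMul.
  by move=> x; exact: is_deriveM.
Qed.

Lemma moment_algebra_derive1n n f : moment_algebra f ->
  moment_algebra (derive1n n f).
Proof.
move=> Af; elim: n => // n /moment_algebra_is_derive[g Ag dg].
suff -> : derive1n n.+1 f = g by [].
by apply/funext => x; rewrite derive1nS derive1E; have [_] := dg x.
Qed.

Lemma is_derive_derive1n_ln n x :
  is_derive x (1 : R) (derive1n n (fun s => ln (M 0%N s)))
    (derive1n n.+1 (fun s => ln (M 0%N s)) x).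
Proof.
suff dn : derivable (derive1n n (fun s => ln (M 0%N s))) x 1.
  by split => //; rewrite derive1nS derive1E.
have dK s : is_derive s (1 : R) (fun u => ln (M 0%N u)) ((M 0%N s)^-1 * M 1%N s).
  exact: (is_derive1_comp (is_derive1_ln (M0_gt0 s)) (M_derive 0 s)).
(* Order 0 is treated apart: it is the derivative of the logarithm, [M 1 / M 0], that lies in the
   algebra. *)
case: n => [|n]; first exact: ex_derive.
rewrite /derive1n iterSr -/(derive1n n _).
have -> : derive1 (fun s => ln (M 0%N s)) = fun s => (M 0%N s)^-1 * M 1%N s.
  by apply/funext => s; rewrite derive1E; have [_] := dK s.
have /moment_algebra_derive1n : moment_algebra (fun s => (M 0%N s)^-1 * M 1%N s).
  by apply: MomentMul; [exact: MomentInv | exact: Moment].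
by move=> /(_ n)/moment_algebra_is_derive[g _ /(_ x)[]].
Qed.

End LogOfSmooth.

Lemma is_derive_precomp_shift {R : realType} (f : R -> R) (b t a : R) :
  is_derive (t + b) 1 f a -> is_derive t (1 : R) (fun u => f (u + b)) a.
Proof.
move=> df; rewrite -[a]mulr1.
exact: (@is_derive1_comp _ f (shift b) _ _ _ df (is_derive_shift _ _ _)).
Qed.

(** The constant [c] disappears at the first derivative, hence the orders [n.+1]. *)
Lemma derive1n_shift {R : realType} (f : R -> R) (b c : R) n :
  (forall k x, is_derive x (1 : R) (derive1n k f) (derive1n k.+1 f x)) ->
  derive1n n.+1 (fun t => f (t + b) - c) = fun t => derive1n n.+1 f (t + b).
Proof.
move=> df; elim: n => [|n IH]; apply/funext => t.
  have [dt dE] := is_derive_precomp_shift (df 0%N (t + b)).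
  by rewrite derive1nS derive1E deriveB// derive_cst subr0.
rewrite derive1nS IH derive1E.
by have [_] := is_derive_precomp_shift (df n.+1 (t + b)).
Qed.

(** * Exponentially tilted moments *)

(** A single term of the exponential series bounds [|x|^k / k!] by [exp |x|]. The sum of two
    exponentials replaces [exp |x|] because integrability is known for the functions [exp (s X)]. *)
Lemma normrX_le_expR {R : realType} (x : R) k :
  `|x| ^+ k <= k`!%:R * (expR x + expR (- x)).
Proof.
have expx : expR `|x| <= expR x + expR (- x).
  by case: (ger0P x) => _; rewrite ?lerDl ?lerDr expR_ge0.
apply: (@le_trans _ _ (k`!%:R * expR `|x|)); last by rewrite ler_wpM2l.
case: k => [|k]; first by rewrite expr0 mul1r -expR0 ler_expR.
rewrite mulrC -ler_pdivrMr ?ltr0n ?fact_gt0//.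
by apply: (le_trans _ (expR_ge1Dxn k (normr_ge0 x))); rewrite lerDr.
Qed.

Section MomentGeneratingFunction.
Context {R : realType} {d : measure_display} {Omega : measurableType d}.
Context (mu : {measure set Omega -> \bar R}) (X W : Omega -> R).
Hypothesis mX : measurable_fun setT X.
Hypothesis mW : measurable_fun setT W.
Hypothesis W_ge0 : forall w, 0 <= W w.
Hypothesis expX_integrable : forall s,
  mu.-integrable setT (EFin \o (fun w => expR (s * X w) * W w)).

(** The unnormalised [k]-th moment of [X] under the measure of density [exp (s X) W]. With
    [W = exp (- phi(X))] and [k = 0] it is the function [M] of the overview. *)
Definition tilted_moment k s := \int[mu]_w (X w ^+ k * expR (s * X w) * W w).

Let measurable_integrand k s :
  measurable_fun setT (fun w => X w ^+ k * expR (s * X w) * W w).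
Proof.
apply: measurable_funM => //; apply: measurable_funM; first exact: measurable_funX.
by apply: measurableT_comp => //; exact: measurable_funM.
Qed.

(* Dominates the integrand uniformly for [s] in [a - 1, a + 1], since
   [|x|^k <= k! exp |x|]. *)
Let dominating k a w := k`!%:R * (expR ((a + 2) * X w) * W w + expR ((a - 2) * X w) * W w
   + (expR (a * X w) * W w + expR (a * X w) * W w)).

Let integrable_dominating k a : mu.-integrable setT (EFin \o dominating k a).
Proof.
apply: (@integrableZl _ _ _ _ _ _ _ (EFin \o _)) => //.
apply: (@integrableD _ _ _ _ _ _ (EFin \o _) (EFin \o _)) => //.
  by apply: (@integrableD _ _ _ _ _ _ (EFin \o _) (EFin \o _)).
by apply: (@integrableD _ _ _ _ _ _ (EFin \o _) (EFin \o _)).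
Qed.

Let dominating_ge0 k a w : 0 <= dominating k a w.
Proof. by rewrite mulr_ge0// !addr_ge0// mulr_ge0// expR_ge0. Qed.

Let le_dominating k a s w : a - 1 < s < a + 1 ->
  `|X w ^+ k * expR (s * X w) * W w| <= dominating k a w.
Proof.
move=> /andP[as1 as2].
rewrite !normrM normrX (ger0_norm (expR_ge0 _)) (ger0_norm (W_ge0 w)) /dominating.
rewrite -!mulrDl mulrA ler_wpM2r//.
rewrite (le_trans (ler_wpM2r (expR_ge0 _) (normrX_le_expR (X w) k)))//.
rewrite -mulrA ler_wpM2l// mulrDl -!expRD.
(* The exponents to bound are [(s + 1) X] and [(s - 1) X]. For [X >= 0] they are at most [(a + 2) X]
   and [a X]; for [X <= 0], at most [a X] and [(a - 2) X]. *)
have [x0|/ltW x0] := leP 0 (X w).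
- apply: lerD.
    rewrite (@le_trans _ _ (expR ((a + 2) * X w)))// ?lerDl ?expR_ge0// ler_expR.
    by rewrite -subr_ge0 (_ : _ - _ = (a + 1 - s) * X w); [rewrite mulr_ge0//; lra|ring].
  rewrite (@le_trans _ _ (expR (a * X w)))// ?lerDl ?expR_ge0// ler_expR.
  by rewrite -subr_ge0 (_ : _ - _ = (a + 1 - s) * X w); [rewrite mulr_ge0//; lra|ring].
- rewrite addrC; apply: lerD.
    rewrite (@le_trans _ _ (expR ((a - 2) * X w)))// ?lerDr ?expR_ge0// ler_expR.
    by rewrite -subr_ge0 (_ : _ - _ = (s + 1 - a) * (- X w)); [rewrite mulr_ge0//; lra|ring].
  rewrite (@le_trans _ _ (expR (a * X w)))// ?lerDl ?expR_ge0// ler_expR.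
  by rewrite -subr_ge0 (_ : _ - _ = (s + 1 - a) * (- X w)); [rewrite mulr_ge0//; lra|ring].
Qed.

Let integrable_integrand k s :
  mu.-integrable setT (EFin \o (fun w => X w ^+ k * expR (s * X w) * W w)).
Proof.
apply: le_integrable (integrable_dominating k s) => //.
  exact/measurable_EFinP.
move=> w _ /=; rewrite lee_fin (ger0_norm (dominating_ge0 _ _ _)).
by apply: le_dominating; lra.
Qed.

Let is_derive_integrand k s w : is_derive s (1 : R)
  (fun u => X w ^+ k * expR (u * X w) * W w) (X w ^+ k.+1 * expR (s * X w) * W w).
Proof.
have dl : is_derive s (1 : R) (fun u : R => u * X w) (X w).
  have := @is_deriveZ _ _ _ _ (X w) _ _ _ (is_derive_id s (1 : R)).
  by rewrite [_ *: _]mulr1; congr is_derive; apply/funext => u; exact: mulrC.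
have de : is_derive s (1 : R) (fun u => expR (u * X w)) (expR (s * X w) * X w).
  exact: (@is_derive1_comp _ _ (fun u => u * X w) _ _ _ (is_derive_expR _) dl).
have dm := @is_deriveZ _ _ _ _ (X w ^+ k * W w) _ _ _ de.
rewrite (_ : _ * W w = X w ^+ k * W w * (expR (s * X w) * X w)); last by rewrite exprS; ring.
by move: dm; congr is_derive; apply/funext => u; rewrite /GRing.scale_fun/= /GRing.scale/=; ring.
Qed.

Lemma is_derive_tilted_moment k s :
  is_derive s (1 : R) (tilted_moment k) (tilted_moment k.+1 s).
Proof.
pose f u w := X w ^+ k * expR (u * X w) * W w.
have sI : [set` `]s - 1, s + 1[] s by rewrite /= in_itv/=; lra.
have f' u w : partial1of2 f u w = X w ^+ k.+1 * expR (u * X w) * W w.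
  by rewrite partial1of2E; have [_] := is_derive_integrand k u w.
have intf u : [set` `]s - 1, s + 1[] u -> mu.-integrable setT (EFin \o f u).
  by move=> _; exact: integrable_integrand.
have df u w : [set` `]s - 1, s + 1[] u -> setT w -> derivable (f ^~ w) u 1.
  by move=> _ _; exact: ex_derive.
have f'_le u w : [set` `]s - 1, s + 1[] u -> setT w ->
    `|partial1of2 f u w| <= dominating k.+1 s w.
  by rewrite /= in_itv/= => us _; rewrite f' le_dominating.
split; first exact: (derivable_under_integral measurableT sI intf df
  (dominating_ge0 k.+1 s) (integrable_dominating k.+1 s) f'_le).
rewrite -derive1E (differentiation_under_integral measurableT sI intf df
  (dominating_ge0 k.+1 s) (integrable_dominating k.+1 s) f'_le).
by apply: eq_Rintegral => w _; rewrite f'.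
Qed.

(** If the integral of this positive function were 0, the whole space would be negligible. *)
Lemma tilted_moment0_gt0 s : mu setT != 0%E -> (forall w, 0 < W w) ->
  0 < tilted_moment 0 s.
Proof.
move=> mu0 W0; rewrite lt_neqAle Rintegral_ge0 ?andbT; last first.
  by move=> w _; rewrite expr0 mul1r mulr_ge0// expR_ge0.
apply: contra mu0 => /eqP E.
have pos w : 0 < X w ^+ 0 * expR (s * X w) * W w.
  by rewrite expr0 mul1r mulr_gt0// expR_gt0.
have : (\int[mu]_w `|(X w ^+ 0 * expR (s * X w) * W w)%:E| = 0)%E.
  under eq_integral => w _ do rewrite abse_EFin ger0_norm ?(ltW (pos w))//.
  rewrite -(fineK (integrable_fin_num measurableT (integrable_integrand 0 s))).
  by rewrite -[fine _]/(tilted_moment 0 s) -E.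
move=> /(ae_eq_integral_abs mu measurableT).
case; first exact/measurable_EFinP.
move=> N [mN N0 sub]; rewrite -measure_le0 -N0.
apply: le_measure; rewrite ?inE// => w _; apply: sub => /= /(_ I) [] /eqP.
by rewrite gt_eqF.
Qed.

End MomentGeneratingFunction.

(** * Cumulants and the operator [D_y] *)

Lemma is_derive_eq_near {R : realType} (f g : R -> R) (x a : R) :
  (\forall z \near x, f z = g z) -> is_derive x (1 : R) g a ->
  is_derive x (1 : R) f a.
Proof.
by move=> fg; apply: near_eq_is_derive; apply: filterS fg => z.
Qed.

Section CumulantRecursion.
Context {R : realType} (U : set R) (T K G : R -> R) (C : R -> R -> R).
Hypothesis U_open : open U.
Hypothesis T_analytic : analytic_on U T.
Hypothesis K_smooth : forall k x,
  is_derive x (1 : R) (derive1n k K) (derive1n k.+1 K x).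
Hypothesis CE : forall z, U z -> C z = fun t => K (t + T z) - K (T z).
Hypothesis GE : forall z, U z -> G z = K (T z).

Let cumulant l z := derive1n l (C z) 0.

Lemma derivable_translated_cgf k z t : U z -> derivable (derive1n k (C z)) t 1.
Proof.
move=> Uz; rewrite CE//; case: k => [|k].
  by apply: derivableB => //; have [] := is_derive_precomp_shift (@K_smooth 0%N (t + T z)).
by rewrite derive1n_shift//; have [] := is_derive_precomp_shift (@K_smooth k.+1 (t + T z)).
Qed.

(** The orders start at 1: at order 0 the cumulant is [C z 0 = 0], not [K (T z)]. *)
Lemma cumulantE l z : U z -> cumulant l.+1 z = derive1n l.+1 K (T z).
Proof. by move=> Uz; rewrite /cumulant CE// derive1n_shift// add0r. Qed.

(** An identity known at [y] alone cannot be differentiated; continuity of [T'] at [y] spreads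
    [T' != 0] to a neighbourhood. *)
Lemma near_analytic_regular y : U y -> derive1 T y != 0 ->
  \forall z \near y, [/\ U z, is_derive z (1 : R) T (derive1 T z) & derive1 T z != 0].
Proof.
move=> Uy T'y; have [g gy dg] := analytic_is_derive T_analytic Uy.
have T'g : \forall z \near y, derive1 T z = g z.
  by apply: filterS dg => z [_]; rewrite derive1E.
have gy0 : g y != 0 by rewrite -(nbhs_singleton T'g).
near=> z.
have T'z : derive1 T z = g z by near: z.
split.
- by near: z; exact: open_nbhs_nbhs.
- by rewrite T'z; near: z.
- by rewrite T'z; near: z; exact: (cvgr_neq0 (g y)).
Unshelve. all: by end_near. Qed.

Lemma is_derive_comp_regular k z : is_derive z (1 : R) T (derive1 T z) ->
  is_derive z (1 : R) (fun u => derive1n k K (T u))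
    (derive1n k.+1 K (T z) * derive1 T z).
Proof.
by move=> dT; exact: (@is_derive1_comp _ (derive1n k K) T).
Qed.

Lemma near_diff_opE k y : U y -> derive1 T y != 0 ->
  \forall z \near y, diff_op T k G z = derive1n k K (T z).
Proof.
move=> Uy T'y; have reg := near_analytic_regular Uy T'y.
elim: k => [|k IH]; first by apply: filterS reg => z [Uz _ _]; exact: GE.
(* [near_join] makes the induction hypothesis hold around each [z] close to [y], so that it can be
   differentiated at [z]. *)
apply: filterS2 reg (near_join IH) => z [Uz dT T'z] IHz.
have dG : derive1 (diff_op T k G) z = derive1n k.+1 K (T z) * derive1 T z.
  rewrite [LHS]derive1E.
  by have [_] := is_derive_eq_near IHz (is_derive_comp_regular k dT).
rewrite -[LHS]/((derive1 T z)^-1 * derive1 (diff_op T k G) z).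
by rewrite dG mulrC mulfK.
Qed.

(** [C z] stands for the conditional cumulant generating function at [z] and [G] for [ln (f_Y / h)];
    probability enters only through [CE] and [GE]. Near [y] both sides reduce to derivatives of [K]
    composed with [T], and dividing by [T'] cancels the chain rule factor. *)
Lemma cumulant_recursion l y : (1 <= l)%N -> U y -> derive1 T y != 0 ->
  [/\ (forall k, (k <= l)%N -> \forall t \near (0 : R),
         derivable (derive1n k (C y)) t 1),
      derivable (cumulant l) y 1,
      (forall k, (k < l)%N -> \forall z \near y, derivable (diff_op T k G) z 1),
      cumulant l.+1 y = (derive1 T y)^-1 * derive1 (cumulant l) y
    & cumulant l y = diff_op T l G y].
Proof.
case: l => // l _ Uy T'y; have reg := near_analytic_regular Uy T'y.
have [_ dT _] := nbhs_singleton reg.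
have nearE : \forall z \near y, cumulant l.+1 z = derive1n l.+1 K (T z).
  by apply: filterS reg => z [Uz _ _]; exact: cumulantE.
have [dc c'E] := is_derive_eq_near nearE (is_derive_comp_regular l.+1 dT).
split => //.
- by move=> k _; near=> t; exact: derivable_translated_cgf.
- move=> k _; apply: filterS2 reg (near_join (near_diff_opE k Uy T'y)) => z [_ dTz _] Ez.
  by have [] := is_derive_eq_near Ez (is_derive_comp_regular k dTz).
- by rewrite [derive1 (cumulant _) _]derive1E c'E cumulantE// mulrC mulfK.
- by rewrite cumulantE// (nbhs_singleton (near_diff_opE l.+1 Uy T'y)).
Unshelve. all: by end_near. Qed.

End CumulantRecursion.

(** * Measurability of the log-partition function *)

(** Tonelli's theorem: integrating a nonnegative jointly measurable function in one variable leaves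
    a measurable function of the other. *)
Lemma measurable_laplace_transform {R : realType} (U : set R) (h T : R -> R) :
  measurable U -> measurable_fun U h -> measurable_fun U T ->
  (forall y, U y -> 0 <= h y) ->
  measurable_fun setT (fun x : R =>
    (\int[@lebesgue_measure R]_(y in U) (h y * expR (x * T y))%:E)%E).
Proof.
move=> mU mh mT h0.
(* Extending [h] and [T] by 0 makes them measurable on the line, and the factor [h] kills the
   integrand outside [U]. *)
have mhU : measurable_fun setT (h \_ U) := (measurable_restrictT h mU).1 mh.
have mTU : measurable_fun setT (T \_ U) := (measurable_restrictT T mU).1 mT.
pose F (p : R * R) := ((h \_ U) p.2 * expR (p.1 * (T \_ U) p.2))%:E.
have -> : (fun x : R => (\int[@lebesgue_measure R]_(y in U) (h y * expR (x * T y))%:E)%E)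
    = fubini_F (@lebesgue_measure R) F.
  apply/funext => x; rewrite /fubini_F [LHS]integral_mkcond; apply: eq_integral => y _.
  rewrite /F /= /patch;  by case: ifPn => // _; rewrite mul0r.
apply: measurable_fun_fubini_tonelli_F.
  apply/measurable_EFinP; apply: measurable_funM.
    exact: (@measurableT_comp _ _ _ _ _ _ (h \_ U)).
  apply: measurableT_comp => //; apply: measurable_funM => //.
  exact: (@measurableT_comp _ _ _ _ _ _ (T \_ U)).
move=> [x y]; rewrite /F /= lee_fin mulr_ge0 ?expR_ge0// /patch.
by case: ifPn => //; rewrite inE => /h0.
Qed.

Lemma analytic_measurable {R : realType} (U : set R) (f : R -> R) :
  open U -> analytic_on U f -> measurable_fun U f.
Proof.
move=> oU fU; apply: open_continuous_measurable_fun => // x; rewrite inE => Ux.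
have [g _ /nbhs_singleton[df _]] := analytic_is_derive fU Ux.
exact/differentiable_continuous/derivable1_diffP.
Qed.

(** A real value of [lne] forces the integral to be positive and finite, so [fine] loses nothing. *)
Lemma log_partitionE {R : realType} (V U : set R) (h T phi : R -> R) x :
  (forall y, U y -> 0 <= h y) -> log_partition V U h T phi -> V x ->
  phi x = ln (fine (\int[@lebesgue_measure R]_(y in U) (h y * expR (x * T y))%:E)%E).
Proof.
move=> h0 /[apply] E; set I := (\int[_]_(_ in _) _)%E in E *.
have I0 : (0 <= I)%E.
  by apply: integral_ge0 => y Uy; rewrite lee_fin mulr_ge0 ?expR_ge0// h0.
have -> : I = (expR (phi x))%:E by rewrite -[LHS]lneK ?in_itv/= ?I0 ?leey// -E.
by rewrite /= expRK.
Qed.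

(** * Bayes' formula for the exponential family *)

Theorem mainTheorem9 (R : realType) (d : measure_display)
    (Omega : measurableType d) (P : probability Omega R)
    (X Y : {RV P >-> R}) (calX calY : set R)
    (h T phi : R -> R) (fYX : R -> R -> R) (fY : R -> R)
    (X_in : forall w, calX (X w)) (Y_in : forall w, calY (Y w))
    (calY_open : open calY)
    (h_base : base_density calY h)
    (h_pos : forall y, calY y -> 0 < h y)
    (T_analytic : analytic_on calY T)
    (T'_zeros : [set y | calY y /\ derive1 T y = 0]
                `<=` isolated [set y | calY y /\ derive1 T y = 0])
    (phi_log_partition : log_partition calX calY h T phi)
    (fYX_cond_pdf : is_conditional_pdf X Y calX calY fYX)
    (fYX_exp_family : forall x y, calX x -> calY y ->
       fYX y x = h y * expR (x * T y - phi x))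
    (fY_marginal : is_marginal_pdf X Y calY fYX fY)
    (fY_pos : forall y, calY y -> 0 < fY y)
    (regular : regularity_conditions X calX calY fYX fY) :
  forall (l : nat) (y : R), (1 <= l)%N -> calY y -> derive1 T y != 0 ->
  [/\ (* the derivatives involved exist *)
      (forall k, (k <= l)%N -> \forall t \near (0 : R),
         derivable (derive1n k (cond_cgf X fYX fY y)) t 1),
      derivable (cond_cumulant X fYX fY l) y 1,
      (forall k, (k < l)%N -> \forall z \near y,
         derivable (diff_op T k (fun u => ln (fY u / h u))) z 1),
      cond_cumulant X fYX fY l.+1 y =
        (derive1 T y)^-1 * derive1 (cond_cumulant X fYX fY l) y
    & cond_cumulant X fYX fY l y =
        diff_op T l (fun u => ln (fY u / h u)) y].
Proof.
move=> l y l1 Uy T'y.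
pose W w := expR (- phi (X w)).
have W_gt0 w : 0 < W w by exact: expR_gt0.
have W_ge0 w : 0 <= W w by exact: expR_ge0.
have [h_ge0 mh _] := h_base.
have mU : measurable calY by exact: open_measurable.
have mX : measurable_fun setT X by exact: measurable_funPT.
have mW : measurable_fun setT W.
  (* Since [X] takes its values in [calX], [phi(X)] can be replaced by its integral formula, a
     composition of measurable maps. *)
  have -> : W = fun w => expR (- ln (fine
      (\int[@lebesgue_measure R]_(y in calY) (h y * expR (X w * T y))%:E)%E)).
    by apply/funext => w; rewrite /W (log_partitionE h_ge0 phi_log_partition (X_in w)).
  have mG := measurable_laplace_transform mU mh
    (analytic_measurable calY_open T_analytic) h_ge0.
  have mfine : measurable_fun setT (@fine R) by [].
  have mlnG := measurableT_comp (@measurable_ln R)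
    (measurableT_comp mfine (measurableT_comp mG mX)).
  by apply: measurableT_comp => //; exact: measurableT_comp mlnG.
pose c z := h z / fY z.
have c_gt0 z : calY z -> 0 < c z by move=> Uz; rewrite divr_gt0 ?h_pos ?fY_pos.
(* Bayes' formula: conditioning on [Y = z] amounts to shifting the tilt [t] by [T z], up to the
   factor [c z]. *)
have weightE z t w : calY z -> expR (t * X w) * (fYX z (X w) / fY z) =
    c z * (expR ((t + T z) * X w) * W w).
  move=> Uz; rewrite fYX_exp_family//.
  by rewrite /c /W mulrDl !expRD [T z * _]mulrC; ring.
have m_exp s : measurable_fun setT (fun w => expR (s * X w) * W w).
  apply: measurable_funM => //; apply: measurableT_comp => //.
  exact: measurable_funM.
have exp_ge0 s w : 0 <= expR (s * X w) * W w by rewrite mulr_ge0 ?expR_ge0.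
have integrable_exp s : P.-integrable setT (EFin \o (fun w => expR (s * X w) * W w)).
  apply/integrableP; split; first exact/measurable_EFinP.
  (* The single point [y] suffices: as [t] ranges over the line, the tilt [t + T y] reaches every
     [s]. The positive factor [c y] cannot hide an infinite integral. *)
  have [/(_ _ Uy) + _ _ _ _] := regular (s - T y).
  rewrite /cond_expectation unlock.
  under eq_integral => w _ do rewrite weightE// subrK EFinM.
  rewrite ge0_integralZl//; last 3 first.
  - exact/measurable_EFinP.
  - by move=> w _; rewrite lee_fin.
  - by rewrite lee_fin ltW ?c_gt0.
  move=> lt_infty; under eq_integral => w _ do rewrite /= ger0_norm//.
  by rewrite ltey; apply: contraTneq lt_infty => ->; rewrite gt0_muley ?lte_fin ?c_gt0.
pose M := tilted_moment P X W.
have M0E s : (\int[P]_w (expR (s * X w) * W w)%:E)%E = (M 0%N s)%:E.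
  rewrite /M /tilted_moment /Rintegral.
  under [in RHS]eq_integral => w _ do rewrite expr0 mul1r.
  by rewrite fineK//; exact: (integrable_fin_num measurableT (integrable_exp s)).
have M_derive : forall k s, is_derive s (1 : R) (M k) (M k.+1 s).
  by move=> k s; exact: is_derive_tilted_moment.
have M0_gt0 s : 0 < M 0%N s.
  have P0 : P setT != 0%E by rewrite probability_setT.
  exact: tilted_moment0_gt0.
have fYE z : calY z -> fY z = h z * M 0%N (T z).
  (* The last clause of [is_marginal_pdf] gives [fY] at every point of [calY], not just almost
     everywhere. *)
  move=> Uz; have [_ _ /(_ _ Uz)] := fY_marginal.
  rewrite unlock.
  under eq_integral => w _.
    rewrite fYX_exp_family// expRD.
    rewrite [X w * _]mulrC -/(W w) EFinM; over.
  rewrite ge0_integralZl//; last 3 first.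
  - exact/measurable_EFinP.
  - by move=> w _; rewrite lee_fin.
  - by rewrite lee_fin ltW ?h_pos.
  by rewrite M0E -EFinM => -[].
pose K s := ln (M 0%N s).
have cgfE z : calY z -> cond_cgf X fYX fY z = fun t => K (t + T z) - K (T z).
  move=> Uz; apply/funext => t; rewrite /cond_cgf /cond_expectation unlock.
  under eq_integral => w _ do rewrite weightE// EFinM.
  rewrite ge0_integralZl//; last 3 first.
  - exact/measurable_EFinP.
  - by move=> w _; rewrite lee_fin.
  - by rewrite lee_fin ltW ?c_gt0.
  (* By [fYE], [c z] is the inverse of [M 0 (T z)], which produces the subtracted term [K (T z)]. *)
  rewrite M0E -EFinM /= /K -ln_div ?posrE// /c fYE//; congr ln.
  by field; rewrite !gt_eqF ?h_pos.
have logE z : calY z -> ln (fY z / h z) = K (T z).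
  by move=> Uz; rewrite fYE// mulrAC divff ?mul1r// gt_eqF ?h_pos.
exact: (cumulant_recursion calY_open T_analytic
  (is_derive_derive1n_ln M_derive M0_gt0) cgfE logE).
Qed.
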